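(* (i) For $X$ and $Y$ non-empty, finite subsets of a metric space $Z$, \[ d_I(\mathcal{M}(X),\mathcal{M}(Y))\le d_{Pr}(\nu_X,\nu_Y), \] where $\mathcal M$ denotes the normalized multicover bifiltration. (ii) If in (i) we assume further that $Z$ is good, then also \[ d_{HI}(\mathcal{S\check C}(X),\mathcal{S\check C}(Y))\le d_{Pr}(\nu_X,\nu_Y), \] where $\mathcal{S\check C}$ denotes the normalized subdivision-Čech bifiltration. (iii) For any non-empty, finite metric spaces $X$ and $Y$, \[ d_{HI}(\mathcal{SR}(X),\mathcal{SR}(Y))\le d_{GPr}(\mu_X,\mu_Y), \] where $\mathcal{SR}$ denotes the normalized subdivision-Rips bifiltration.
   Context: **Good metric spaces.** A metric space is good if the intersection of any finite collection of open balls is either empty or contractible. $B(x,r)$ denotes the open ball of radius $r$ centered at $x$. **Measures.** For $X$ a non-empty finite metric space, $\mu_X$ is the uniform probability measure, $\mu_X(A)=|A|/|X|$. If $X\subset Z$ for a metric space $Z$, $\nu_X$ is the Borel measure on $Z$ given by $\nu_X(A)=|A\cap X|/|X|$. The Prohorov distance between Borel measures $\mu,\eta$ on a metric space $Z$ is \[ d_{Pr}(\mu,\eta)=\sup_A\inf\{\delta\ge 0 \mid \mu(A)\le\eta(A^\delta)+\delta \text{ and } \eta(A)\le\mu(A^\delta)+\delta\}, \] where $A\subset Z$ ranges over closed sets and $A^\delta$ is the set of points of $Z$ at distance $<\delta$ from some $a\in A$. The Gromov–Prohorov distance between metric measure spaces $\mathcal X,\mathcal Y$ with measures $\eta_{\mathcal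 X},\eta_{\mathcal Y}$ is $d_{GPr}(\mathcal X,\mathcal Y)=\inf_{\varphi,\psi}d_{Pr}(\varphi_*\eta_{\mathcal X},\psi_*\eta_{\mathcal Y})$, where $\varphi:\mathcal X\to W$, $\psi:\mathcal Y\to W$ range over isometric embeddings into a common metric space $W$; a metric measure space is denoted by its measure. **Bifiltrations.** $J=(0,\infty)^{\mathrm{op}}\times(0,\infty)$, so $(k,r)\le(k',r')$ iff $k\ge k'$ and $r\le r'$. All bifiltrations below are functors from $J$ to topological spaces with internal maps inclusions; simplicial complexes are regarded as spaces via geometric realization. - For $X\subset Z$ non-empty finite, $\mathcal M(X)_{(k,r)}=\{y\in Z\mid \nu_X(B(y,r))\ge k\}$. - For $X\subset Z$, the Čech complex $\check{\mathcal C}(X)_r$ is the nerve of the balls $B(x,r)\subset Z$, $x\in X$: its vertex set is $X$ (balls are indexed by their centers), and its simplices are the non-empty finite $\sigma\subset X$ with $\bigcap_{x\in\sigma}B(x,r)\ne\emptyset$. - For a metric space $(X,\partial_X)$, the Rips complex $\mathcal R(X)_r$ is the clique complex of the graph with vertex set $X$ and edges $[x,y]$, $x\neq y$, $\partial_X(x,y)<2r$. - For a simplicial complex $T$ and $k>0$, $\mathcal S(T)_k$ is the subcomplex of the barycentric subdivision of $T$ (whose simplices are flags $\sigma_1\subsetneq\cdots\subsetneq\sigma_m$ of simplices of $T$) consisting of flags whose minimum element $\sigma_1$ has dimension at least $k-1$. - For $X$ non-empty finite, $\mathcal{S\check C}(X)_{(k,r)}=\mathcal S(\check{\mathcal C}(X)_r)_{k|X|}$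 and $\mathcal{SR}(X)_{(k,r)}=\mathcal S(\mathcal R(X)_r)_{k|X|}$. **Interleavings.** A forward shift is a poset automorphism $\gamma$ of $\mathbb R^{\mathrm{op}}\times\mathbb R$ (ordered by $(a,b)\le(c,d)$ iff $a\ge c$ and $b\le d$) with $x\le\gamma(x)$ for all $x\in J$; for $\delta\ge0$, $\tau^\delta(x,y)=(x-\delta,y+\delta)$. For forward shifts $\gamma,\kappa$, the thin category $\mathbf I^{\gamma,\kappa}$ has objects $J\times\{0,1\}$ and a morphism $(r,i)\to(s,j)$ iff: $i=j$ and $r\le s$; or $i=0,j=1$ and $\gamma(r)\le s$; or $i=1,j=0$ and $\kappa(r)\le s$. Functors $F,G:J\to\mathbf{Top}$ are $(\gamma,\kappa)$-interleaved if there is a functor $\mathbf I^{\gamma,\kappa}\to\mathbf{Top}$ restricting to $F$ on $J\times\{0\}$ and to $G$ on $J\times\{1\}$. They are $\delta$-interleaved if they are $(\tau^\delta,\tau^\delta)$-interleaved, and $d_I(F,G)=\inf\{\delta\mid F,G\text{ are }\delta\text{-interleaved}\}$. Functors $F,G:J\to\mathbf{Top}$ are weakly equivalent if they are connected by a finite zigzag of natural transformations each of which is objectwise a weak homotopy equivalence. $F,G$ are $(\gamma,\kappa)$-homotopy interleaved if there are $F'$ weakly equivalent to $F$ and $G'$ weakly equivalent to $G$ with $F',G'$ $(\gamma,\kappa)$-interleaved; $\delta$-homotopy interleaved means $(\tau^\delta,\tau^\delta)$-homotopy interleaved; $d_{HI}(F,G)=\inf\{\delta\mid F,G\text{ are }\delta\text{-homotopy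 interleaved}\}$. *)

(* Defs.v *)
From HB Require Import structures.
From mathcomp Require Import all_boot all_order all_algebra finmap.
From mathcomp Require Import all_classical all_reals all_analysis.
From Stdlib Require Import Relations.Relation_Operators.

Set Implicit Arguments.
Unset Strict Implicit.
Unset Printing Implicit Defensive.

Import Order.TTheory GRing.Theory Num.Theory.
Import numFieldNormedType.Exports.

Local Open Scope classical_set_scope.
Local Open Scope ring_scope.

#[short(type="finMetricType")]
HB.structure Definition FinMetric (R : numDomainType) :=
  {M of Metric R M & Finite M}.

(** * Borel measures, Prohorov and Gromov-Prohorov distances *)

(* The library's [{measure set T -> \bar R}] requires [T] to be pointed, which
   an arbitrary metric space is not. As there, the values on sets that are not
   Borel are unconstrained. *)
Record borel_measure (R : realType) (Z : topologicalType) := BorelMeasure {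
  bm_fun :> set Z -> \bar R;
  bm_set0 : bm_fun set0 = 0%E;
  bm_ge0 : forall A, <<s open >> A -> (0 <= bm_fun A)%E;
  bm_sigma_additive : forall F : (set Z)^nat,
    (forall n, <<s open >> (F n)) -> trivIset setT F ->
    (\sum_(0 <= i < n) bm_fun (F i))%E @[n --> \oo]
      --> bm_fun (\bigcup_n F n) }.

Section uniform_measure.
Context (R : realType) (I : finType) (Z : topologicalType) (f : I -> Z).

(* The image under [f] of the uniform probability measure on [I]. *)
Definition unif (A : set Z) : \bar R :=
  (#|[pred i | f i \in A]|%:R / #|I|%:R)%:E.

Lemma unifE A : unif A = ((\sum_i \1_A (f i)) / #|I|%:R)%:E.
Proof.
rewrite /unif -sum1_card natr_sum big_mkcond/=; congr ((_ / _)%:E).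
by apply: eq_bigr => i _; rewrite indicE inE; case: (_ \in _).
Qed.

Lemma unif_set0 : unif set0 = 0%E.
Proof. by rewrite unifE big1 ?mul0r// => i _; rewrite indic0. Qed.

Lemma unif_ge0 A : <<s open >> A -> (0 <= unif A)%E.
Proof. by move=> _; rewrite lee_fin divr_ge0. Qed.

Lemma unif_sigma_additive (F : (set Z)^nat) :
  (forall n, <<s open >> (F n)) -> trivIset setT F ->
  (\sum_(0 <= i < n) unif (F i))%E @[n --> \oo] --> unif (\bigcup_n F n).
Proof.
move=> _ tF; rewrite unifE.
have -> : (fun n => (\sum_(0 <= i < n) unif (F i))%E) =
    (fun n => ((\sum_i \sum_(0 <= j < n) \1_(F j) (f i)) / #|I|%:R)%:E).
  apply/funext => n; under eq_bigr do rewrite unifE.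
  by rewrite sumEFin -mulr_suml exchange_big.
apply: cvg_EFin; first by near=> n.
apply: cvgMr_tmp; apply: cvg_big => [|i _]; first exact: add_continuous.
have [[k _ Fk]|nF] := pselect ((\bigcup_n F n) (f i)).
- apply: cvg_near_cst; near=> n.
  rewrite [RHS]indicE mem_set; last by exists k.
  rewrite (@big_cat_nat _ _ _ k.+1)//=; last by near: n; exact: nbhs_infty_ge.
  rewrite big_nat_recr//= indicE (mem_set Fk) big_nat big1 ?add0r.
    rewrite big_nat big1 ?addr0// => j /andP[kj _].
    rewrite indicE memNset// => Fj.
    have E := tF k j Logic.I Logic.I (ex_intro _ (f i) (conj Fk Fj)).
    by rewrite E ltnn in kj.
  move=> j /andP[_ jk]; rewrite indicE memNset// => Fj.
  have E := tF k j Logic.I Logic.I (ex_intro _ (f i) (conj Fk Fj)).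
  by rewrite E ltnn in jk.
- rewrite indicE memNset//.
  apply: cvg_near_cst; near=> n; rewrite big1// => j _.
  by rewrite indicE memNset// => Fj; apply: nF; exists j.
Unshelve. all: by end_near. Qed.

Definition unif_measure : borel_measure R Z :=
  BorelMeasure unif_set0 unif_ge0 unif_sigma_additive.

End uniform_measure.

Section prohorov.
Context (R : realType).

(* [nu X A = |A :&: X| / |X|]: the inclusion of the finite type of elements of
   [X] into [Z] is [val]. *)
Definition nu (Z : metricType R) (X : {fset Z}) : borel_measure R Z :=
  unif_measure R (fun x : X => val x).

Definition mu (X : finMetricType R) : borel_measure R X :=
  unif_measure R (@idfun X).

Definition thickening (Z : metricType R) (A : set Z) (d : R) : set Z :=
  [set z | exists2 a, A a & mdist z a < d].

Definition prohorov (Z : metricType R) (m e : borel_measure R Z) : \bar R :=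
  ereal_sup [set ereal_inf [set d%:E | d in [set d : R |
      [/\ 0 <= d,
          (m A <= e (thickening A d) + d%:E)%E &
          (e A <= m (thickening A d) + d%:E)%E]]] | A in closed].

Record isometric_embedding (X W : metricType R) := IsometricEmbedding {
  isom_fun :> X -> W;
  isom_dist : forall x y, mdist (isom_fun x) (isom_fun y) = mdist x y }.

Lemma isom_continuous (X W : metricType R) (f : isometric_embedding X W) :
  continuous f.
Proof.
move=> x; apply/metricType_numDomainType.cvgrPdist_lt => e e0.
apply/nbhs_ballP; exists e => //= y.
by rewrite ballEmdist /= isom_dist.
Qed.

Lemma borel_preimage (X W : topologicalType) (f : X -> W) : continuous f ->
  forall A, <<s open >> A -> <<s open >> (f @^-1` A).
Proof.
move=> cf; suff: <<s (@open W) >> `<=` [set A | <<s open >> (f @^-1` A)] by [].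
apply: smallest_sub.
  split=> [|A sA|F sF] /=.
  - by rewrite preimage_set0; exact: sigma_algebra0.
  - rewrite setTD preimage_setC -setTD; exact: sigma_algebraCD.
  - by rewrite preimage_bigcup; exact: sigma_algebra_bigcup.
move=> A oA /=; apply: sub_sigma_algebra.
by move: A oA; exact/continuousP.
Qed.

Section image_measure.
Context (X W : metricType R) (f : isometric_embedding X W).
Variable m : borel_measure R X.

Let push (A : set W) : \bar R := m (f @^-1` A).

Let push0 : push set0 = 0%E.
Proof. by rewrite /push preimage_set0 bm_set0. Qed.

Let push_ge0 A : <<s open >> A -> (0 <= push A)%E.
Proof.
by move=> sA; apply: bm_ge0; apply: borel_preimage => //; exact: isom_continuous.
Qed.

Let push_sigma_additive (F : (set W)^nat) :
  (forall n, <<s open >> (F n)) -> trivIset setT F ->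
  (\sum_(0 <= i < n) push (F i))%E @[n --> \oo] --> push (\bigcup_n F n).
Proof.
move=> sF tF; rewrite /push preimage_bigcup; apply: bm_sigma_additive.
  by move=> n; apply: borel_preimage => //; exact: isom_continuous.
by move=> i j _ _ [x [xi xj]]; apply: (tF i j) => //; exists (f x).
Qed.

Definition image_measure : borel_measure R W :=
  BorelMeasure push0 push_ge0 push_sigma_additive.

End image_measure.

Definition gromov_prohorov (X Y : metricType R)
    (mX : borel_measure R X) (mY : borel_measure R Y) : \bar R :=
  ereal_inf [set e | exists (W : metricType R)
    (phi : isometric_embedding X W) (psi : isometric_embedding Y W),
    e = prohorov (image_measure phi mX) (image_measure psi mY)].

End prohorov.

(** * Homotopy theory *)

Section homotopy.
Context (R : realType).

Definition unit_interval : set R := `[0, 1].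

Lemma unit_interval0 : 0 \in unit_interval.
Proof. by apply/mem_set; rewrite /unit_interval/= in_itv/= lexx ler01. Qed.

Lemma unit_interval1 : 1 \in unit_interval.
Proof. by apply/mem_set; rewrite /unit_interval/= in_itv/= lexx ler01. Qed.

Definition I0 : unit_interval := exist _ 0 unit_interval0.
Definition I1 : unit_interval := exist _ 1 unit_interval1.

Definition cube n : set 'rV[R]_n := [set v | forall i, 0 <= v ord0 i <= 1].
Arguments cube n _ : clear implicits.

Definition cube_boundary n (v : cube n) : Prop :=
  exists i, val v ord0 i = 0 \/ val v ord0 i = 1.

Definition joined_by_path (X : topologicalType) (x y : X) : Prop :=
  exists p : unit_interval -> X, [/\ continuous p, p I0 = x & p I1 = y].

(* Representatives of elements of [pi_n (X, x)]. *)
Definition spheroid (X : topologicalType) n (x : X) (a : cube n -> X) : Prop :=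
  continuous a /\ forall v, cube_boundary v -> a v = x.

Definition spheroid_homotopic (X : topologicalType) n (x : X)
    (a b : cube n -> X) : Prop :=
  exists H : (unit_interval * cube n)%type -> X,
    [/\ continuous H,
        forall v, H (I0, v) = a v,
        forall v, H (I1, v) = b v &
        forall t v, cube_boundary v -> H (t, v) = x].

(* Bijectivity on [pi_0], and on [pi_n] for all n >= 1 and all base points;
   the induced maps on [pi_n] are always homomorphisms, so that their being
   isomorphisms means their being bijective. *)
Definition weak_homotopy_equivalence (X Y : topologicalType) (f : X -> Y)
    : Prop :=
  [/\ continuous f,
      (forall x x', joined_by_path (f x) (f x') -> joined_by_path x x') /\
      (forall y, exists x, joined_by_path (f x) y) &
      forall n (x : X),
        (forall a b : cube n.+1 -> X, spheroid x a -> spheroid x b ->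
           spheroid_homotopic (f x) (f \o a) (f \o b) ->
           spheroid_homotopic x a b) /\
        (forall b : cube n.+1 -> Y, spheroid (f x) b ->
           exists2 a : cube n.+1 -> X, spheroid x a &
             spheroid_homotopic (f x) (f \o a) b)].

Definition contractible (X : topologicalType) : Prop :=
  exists (x0 : X) (H : (unit_interval * X)%type -> X),
    [/\ continuous H, forall x, H (I0, x) = x & forall x, H (I1, x) = x0].

(* The collection of balls is non-empty: its intersection is then independent
   of an ambient space. *)
Definition good (Z : metricType R) : Prop :=
  forall (n : nat) (c : 'I_n.+1 -> Z) (r : 'I_n.+1 -> R),
    let A := \bigcap_(i in setT) ball (c i) (r i) in
    A = set0 \/ contractible A.

End homotopy.
Arguments unit_interval R _ : clear implicits.
Arguments cube R n _ : clear implicits.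

(** * Functors from a preorder to topological spaces *)

(* [le] is meant to be a preorder, seen as a thin category. *)
Record top_functor (P : Type) (le : rel P) := TopFunctor {
  tf_obj :> P -> topologicalType;
  tf_map : forall x y, le x y -> tf_obj x -> tf_obj y;
  tf_continuous : forall x y (h : le x y), continuous (tf_map h);
  tf_id : forall x (h : le x x) p, tf_map h p = p;
  tf_comp : forall x y z (hxy : le x y) (hyz : le y z) (hxz : le x z) p,
    tf_map hyz (tf_map hxy p) = tf_map hxz p }.

Section functors.
Context (P : Type) (le : rel P).

Definition tf_precomp (Q : Type) (leQ : rel Q) (e : P -> Q)
    (he : forall x y, le x y -> leQ (e x) (e y)) (H : top_functor leQ) :
    top_functor le :=
  @TopFunctor P le (fun x => H (e x)) (fun x y h => tf_map (he x y h))
    (fun x y h => @tf_continuous _ _ H _ _ (he x y h)) (fun x h => @tf_id _ _ H _ (he x x h))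
    (fun x y z hxy hyz hxz =>
       @tf_comp _ _ H _ _ _ (he x y hxy) (he y z hyz) (he x z hxz)).

Section subspaces.
Context (U : topologicalType).

Definition subspace_incl (A B : set U) (AB : A `<=` B) (x : A) : B :=
  exist _ (val x) (mem_set (AB _ (set_mem (valP x)))).

Lemma subspace_incl_continuous (A B : set U) (AB : A `<=` B) :
  continuous (subspace_incl AB).
Proof.
apply/continuousP => _ [W oW <-]; exists W => //.
Qed.

Context (A : P -> set U) (mA : forall x y, le x y -> A x `<=` A y).

Lemma subspace_incl_id x (h : le x x) (p : A x) : subspace_incl (mA h) p = p.
Proof. exact: val_inj. Qed.

Lemma subspace_incl_comp x y z (hxy : le x y) (hyz : le y z) (hxz : le x z)
    (p : A x) :
  subspace_incl (mA hyz) (subspace_incl (mA hxy) p) = subspace_incl (mA hxz) p.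
Proof. exact: val_inj. Qed.

Definition filtration : top_functor le :=
  @TopFunctor P le (fun x => A x) (fun x y h => subspace_incl (mA h))
    (fun x y h => @subspace_incl_continuous _ _ (mA h))
    subspace_incl_id subspace_incl_comp.

End subspaces.

Definition objectwise_weak_equivalence (R : realType) (F G : top_functor le)
    : Prop :=
  exists eta : forall x, F x -> G x,
    (forall x y (h : le x y) p, eta y (tf_map h p) = tf_map h (eta x p)) /\
    (forall x, weak_homotopy_equivalence R (eta x)).

Definition weakly_equivalent (R : realType) :
    top_functor le -> top_functor le -> Prop :=
  clos_refl_sym_trans (top_functor le) (objectwise_weak_equivalence R).

End functors.

(** * Interleavings *)

Section interleavings.
Context (R : realType).

(* The order of [R^op * R]. *)
Definition grade_le (a b : R * R) : bool := (b.1 <= a.1) && (a.2 <= b.2).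

Definition J : Type := {a : R * R | (0 < a.1) && (0 < a.2)}.

Definition J_le (a b : J) : bool := grade_le (val a) (val b).

Definition bifiltration := top_functor J_le.

Record forward_shift := ForwardShift {
  fs_fun :> R * R -> R * R;
  fs_bij : bijective fs_fun;
  fs_mono : forall a b, grade_le (fs_fun a) (fs_fun b) = grade_le a b;
  fs_ge : forall a : J, grade_le (val a) (fs_fun (val a)) }.

Section tau.
Context (d : {nonneg R}).

Let tau_fun (a : R * R) : R * R := (a.1 - d%:num, a.2 + d%:num).

Let tau_bij : bijective tau_fun.
Proof.
by exists (fun a => (a.1 + d%:num, a.2 - d%:num)) => -[a b];
  rewrite /tau_fun/= ?addrK ?subrK.
Qed.

Let tau_mono a b : grade_le (tau_fun a) (tau_fun b) = grade_le a b.
Proof. by rewrite /grade_le/= lerD2r lerD2r. Qed.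

Let tau_ge (a : J) : grade_le (val a) (tau_fun (val a)).
Proof. by rewrite /grade_le/= gerBl lerDl !ge0. Qed.

Definition tau : forward_shift := ForwardShift tau_bij tau_mono tau_ge.

End tau.

Section interleaving.
Context (gamma kappa : forward_shift).

(* The thin category [I^(gamma, kappa)]; [false] stands for 0, [true] for 1. *)
Definition interleaving_le (a b : J * bool) : bool :=
  match a.2, b.2 with
  | false, true => grade_le (gamma (val a.1)) (val b.1)
  | true, false => grade_le (kappa (val a.1)) (val b.1)
  | _, _ => J_le a.1 b.1
  end.

Lemma interleaving_le_pair (i : bool) (x y : J) :
  J_le x y -> interleaving_le (x, i) (y, i).
Proof. by case: i. Qed.

Definition interleaved (F G : bifiltration) : Prop :=
  exists H : top_functor interleaving_le,
    tf_precomp (@interleaving_le_pair false) H = F /\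
    tf_precomp (@interleaving_le_pair true) H = G.

Definition homotopy_interleaved (F G : bifiltration) : Prop :=
  exists F' G' : bifiltration,
    [/\ weakly_equivalent R F' F, weakly_equivalent R G' G &
        interleaved F' G'].

End interleaving.

Definition dI (F G : bifiltration) : \bar R :=
  ereal_inf [set (d%:num)%:E |
    d in [set d : {nonneg R} | interleaved (tau d) (tau d) F G]].

Definition dHI (F G : bifiltration) : \bar R :=
  ereal_inf [set (d%:num)%:E |
    d in [set d : {nonneg R} | homotopy_interleaved (tau d) (tau d) F G]].

End interleavings.

(** * Simplicial complexes *)

(* Simplicial complexes with vertices among a finite type [V]; not every
   element of [V] need be a vertex. *)
Record scomplex (V : finType) := SComplex {
  faces :> {set {set V}};
  faces_neq0 : finset.set0 \notin faces;
  faces_sub : forall s t : {set V},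
    s \in faces -> t \subset s -> t != finset.set0 -> t \in faces }.

Section realization.
Context (R : realType) (V : finType).

(* Barycentric coordinates: as [V] is finite, the geometric realization has the
   topology of a subspace of the Euclidean space [R^V]. *)
Definition realization (T : scomplex V) : set {ptws V -> R} :=
  [set t | [/\ forall v, 0 <= t v, \sum_v t v = 1 &
               [set v | t v != 0]%SET \in T]].

Lemma realizationS (T T' : scomplex V) :
  (T : {set _}) \subset T' -> realization T `<=` realization T'.
Proof. by move=> TT' t [t0 t1 tT]; split=> //; exact: (fintype.subsetP TT'). Qed.

Definition simplex_dim (s : {set V}) : int := #|s|%:Z - 1.

(* Flags of simplices of [T], written as sets of simplices, whose minimum
   element has dimension at least [k - 1]. *)
Definition subdiv_faces (T : scomplex V) (k : R) : {set {set {set V}}} :=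
  [set F : {set {set V}} | [&& F \subset T,
     [forall s in F, forall t in F, (s \subset t) || (t \subset s)] &
     [exists s in F, [forall t in F, s \subset t] &&
                     (k - 1 <= (simplex_dim s)%:~R)]]]%SET.

Lemma subdiv_neq0 (T : scomplex V) (k : R) : finset.set0 \notin subdiv_faces T k.
Proof.
rewrite inE; apply/negP => /and3P[_ _ /exists_inP[s]].
by rewrite inE.
Qed.

Lemma chain_min (F : {set {set V}}) : F != finset.set0 ->
  [forall s in F, forall t in F, (s \subset t) || (t \subset s)] ->
  exists2 s, s \in F & forall t, t \in F -> s \subset t.
Proof.
move=> /set0Pn[s0 s0F] /forall_inP chF.
case: (arg_minnP (fun s : {set V} => #|s|) s0F) => s sF smin.
exists s => // t tF.
have /orP[//|ts] := forall_inP (chF _ sF) _ tF.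
suff -> : t = s by [].
by apply/eqP; rewrite eqEcard ts smin.
Qed.

Lemma subdiv_sub (T : scomplex V) (k : R) (F G : {set {set V}}) :
  F \in subdiv_faces T k -> G \subset F -> G != finset.set0 ->
  G \in subdiv_faces T k.
Proof.
rewrite !inE => /and3P[FT chF /exists_inP[s sF /andP[/forall_inP smin ks]]] GF G0.
have chG : [forall s in G, forall t in G, (s \subset t) || (t \subset s)].
  apply/forall_inP => a aG; apply/forall_inP => b bG.
  exact: (forall_inP (forall_inP chF _ (fintype.subsetP GF _ aG)) _ (fintype.subsetP GF _ bG)).
rewrite (fintype.subset_trans GF FT) chG /=.
have [t tG tmin] := chain_min G0 chG.
apply/exists_inP; exists t => //; apply/andP; split; first exact/forall_inP.
apply: le_trans ks _; rewrite ler_int lerD2r lez_nat.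
by apply: subset_leq_card; exact: smin (fintype.subsetP GF _ tG).
Qed.

Definition subdiv (T : scomplex V) (k : R) : scomplex {set V} :=
  SComplex (subdiv_neq0 T k) (@subdiv_sub T k).

Lemma subdivS (T T' : scomplex V) (k k' : R) :
  (T : {set _}) \subset T' -> k' <= k ->
  (subdiv T k : {set _}) \subset subdiv T' k'.
Proof.
move=> TT' kk'; apply/fintype.subsetP => F; rewrite !inE.
move=> /and3P[FT -> /exists_inP[s sF /andP[smin ks]]].
rewrite (fintype.subset_trans FT TT') /=; apply/exists_inP; exists s => //.
by rewrite smin (le_trans _ ks)// lerD2r.
Qed.

End realization.
Arguments realization R [V] T _.

Section cech_rips.
Context (R : realType).

Section cech.
Context (Z : metricType R) (X : {fset Z}).

Definition balls_meet (r : R) (s : {set X}) : Prop :=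
  \bigcap_(x in [set` s]) ball (val x) r !=set0.

Definition cech_faces (r : R) : {set {set X}} :=
  [set s : {set X} | (s != finset.set0) && `[< balls_meet r s >]]%SET.

Lemma cech_neq0 r : finset.set0 \notin cech_faces r.
Proof. by rewrite inE eqxx. Qed.

Lemma cech_sub r (s t : {set X}) :
  s \in cech_faces r -> t \subset s -> t != finset.set0 -> t \in cech_faces r.
Proof.
rewrite !inE => /andP[_ /asboolP[z zs]] ts -> /=; apply/asboolP.
by exists z => x xt; apply: zs; exact: (fintype.subsetP ts).
Qed.

Definition cech (r : R) : scomplex X := SComplex (cech_neq0 r) (@cech_sub r).

Lemma cechS (r r' : R) : r <= r' -> (cech r : {set _}) \subset cech r'.
Proof.
move=> rr'; apply/fintype.subsetP => s; rewrite !inE => /andP[-> /asboolP[z zs]] /=.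
apply/asboolP; exists z => x xs; have := zs x xs.
by rewrite !ballEmdist /= => /lt_le_trans; exact.
Qed.

End cech.

Section rips.
Context (X : finMetricType R).

Definition rips_edge (r : R) (x y : X) : bool :=
  (x != y) && (mdist x y < 2 * r).

Definition rips_faces (r : R) : {set {set X}} :=
  [set s : {set X} | (s != finset.set0) &&
     [forall x in s, forall y in s, (x != y) ==> rips_edge r x y]]%SET.

Lemma rips_neq0 r : finset.set0 \notin rips_faces r.
Proof. by rewrite inE eqxx. Qed.

Lemma rips_sub r (s t : {set X}) :
  s \in rips_faces r -> t \subset s -> t != finset.set0 -> t \in rips_faces r.
Proof.
rewrite !inE => /andP[_ /forall_inP es] /fintype.subsetP ts -> /=.
apply/forall_inP => x xt; apply/forall_inP => y yt.
exact: (forall_inP (es _ (ts _ xt)) _ (ts _ yt)).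
Qed.

Definition rips (r : R) : scomplex X := SComplex (rips_neq0 r) (@rips_sub r).

Lemma ripsS (r r' : R) : r <= r' -> (rips r : {set _}) \subset rips r'.
Proof.
move=> rr'; apply/fintype.subsetP => s; rewrite !inE => /andP[-> /forall_inP es] /=.
apply/forall_inP => x xs; apply/forall_inP => y ys; apply/implyP => xy.
have /implyP/(_ xy)/andP[_ xyr] := forall_inP (es _ xs) _ ys.
by rewrite /rips_edge xy (lt_le_trans xyr)// ler_pM2l.
Qed.

End rips.
End cech_rips.

(** * The bifiltrations *)

Section bifiltrations.
Context (R : realType).

Definition multicover_set (Z : metricType R) (X : {fset Z}) (a : J R) : set Z :=
  [set y | ((val a).1%:E <= nu X (ball y (val a).2))%E].

Lemma multicover_setS (Z : metricType R) (X : {fset Z}) (a b : J R) :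
  J_le a b -> multicover_set X a `<=` multicover_set X b.
Proof.
move=> /andP[kk' rr'] y; rewrite /multicover_set/= => ky.
apply: (@le_trans _ _ (val a).1%:E); first by rewrite lee_fin.
apply: le_trans ky _; rewrite lee_fin ler_wpM2r// ler_nat.
apply: subset_leq_card; apply/fintype.subsetP => x; rewrite !inE.
by rewrite !ballEmdist => /lt_le_trans; exact.
Qed.

Definition multicover (Z : metricType R) (X : {fset Z}) : bifiltration R :=
  filtration (@multicover_setS Z X).

Definition subdiv_cech_set (Z : metricType R) (X : {fset Z}) (a : J R) :
    set {ptws {set X} -> R} :=
  realization R (subdiv (cech X (val a).2) ((val a).1 * #|` X|%:R)).
Arguments subdiv_cech_set [Z] X a _.

Lemma subdiv_cech_setS (Z : metricType R) (X : {fset Z}) (a b : J R) :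
  J_le a b -> subdiv_cech_set X a `<=` subdiv_cech_set X b.
Proof.
move=> /andP[kk' rr']; apply: realizationS; apply: subdivS; first exact: cechS.
by rewrite ler_wpM2r.
Qed.

Definition subdiv_cech (Z : metricType R) (X : {fset Z}) : bifiltration R :=
  filtration (@subdiv_cech_setS Z X).

Definition subdiv_rips_set (X : finMetricType R) (a : J R) :
    set {ptws {set X} -> R} :=
  realization R (subdiv (rips X (val a).2) ((val a).1 * #|X|%:R)).
Arguments subdiv_rips_set X a _ : clear implicits.

Lemma subdiv_rips_setS (X : finMetricType R) (a b : J R) :
  J_le a b -> subdiv_rips_set X a `<=` subdiv_rips_set X b.
Proof.
move=> /andP[kk' rr']; apply: realizationS; apply: subdivS; first exact: ripsS.
by rewrite ler_wpM2r.
Qed.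

Definition subdiv_rips (X : finMetricType R) : bifiltration R :=
  filtration (@subdiv_rips_setS X).

End bifiltrations.

(* Main.v *)
Require Import Defs.
From HB Require Import structures.
From mathcomp Require Import all_boot all_order all_algebra finmap.
From mathcomp Require Import all_classical all_reals all_analysis.
From mathcomp Require Import lra.
From Stdlib Require Import Relations.Relation_Operators.

(** Call a point a common centre of a set [s] of data points at scale [r] if all
    points of [s] are near it. The simplices of the subdivision complexes
    are chains in the poset P(k, r) of sets of at least k|X| data points
    that have a common centre. Dually, let Q(k, r) be the poset of non-empty
    sets of centres that have at least k|X| data points near all of them.
    "Common centres" and "common points" form a Galois connection between P
    and the opposite of Q, but are not natural in r. Glue P below the
    opposite of Q along the relation "every point of s is near every centre
    of S": removing layer by layer the elements of P, or those of Q, deforms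
    the order complex of the union onto that of Q, or of P, and the zigzag
    of inclusions is natural. Unlike P, the poset Q does not remember the
    data set, so a bound on the Prohorov distance makes the Q's of two data
    sets literally interleaved. The multicover bifiltration is the part of Q
    consisting of singletons. *)

Set Implicit Arguments.
Unset Strict Implicit.
Unset Printing Implicit Defensive.

Import Order.TTheory GRing.Theory Num.Theory.
Import numFieldNormedType.Exports.

Local Open Scope classical_set_scope.
Local Open Scope ring_scope.

(** * Deformation retracts and weak homotopy equivalences *)

Lemma continuous_pair (X Y Z : topologicalType) (f : X -> Y) (g : X -> Z) :
  continuous f -> continuous g -> continuous (fun x => (f x, g x)).
Proof. by move=> cf cg x; exact: (cvg_pair (cf x) (cg x)). Qed.

(** [H] keeps the image of [f] fixed, hence all base points in it. Injectivity follows by composing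
    with [g], surjectivity by following [H]. *)
Lemma deformation_retract_weak_equivalence (R : realType)
    (X Y : topologicalType) (f : X -> Y) (g : Y -> X)
    (H : unit_interval R * Y -> Y) :
  continuous f -> continuous g -> continuous H -> cancel f g ->
  (forall y, H (I0 R, y) = f (g y)) -> (forall y, H (I1 R, y) = y) ->
  (forall t x, H (t, f x) = f x) ->
  weak_homotopy_equivalence R f.
Proof.
move=> cf cg cH fK H0 H1 Hf.
have cHr (T : topologicalType) (b : T -> Y) : continuous b ->
    continuous (fun p : unit_interval R * T => H (p.1, b p.2)).
  move=> cb p; apply: (@continuous_comp _ _ _ (fun p => (p.1, b p.2)) H).
    apply: continuous_pair => [q|q]; first exact: cvg_fst.
    by apply: continuous_comp; [exact: cvg_snd | exact: cb].
  exact: cH.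
split=> //; first split.
- move=> x x' [p [cp p0 p1]]; exists (g \o p); split.
  + by move=> t; apply: continuous_comp; [exact: cp | exact: cg].
  + by rewrite /= p0 fK.
  + by rewrite /= p1 fK.
- move=> y; exists (g y), (fun t => H (t, y)); split=> // t.
  apply: (@continuous_comp _ _ _ (fun t => (t, y)) H); last exact: cH.
  by apply: continuous_pair; [move=> u; exact: cvg_id | exact: cst_continuous].
- move=> n x; split=> [a b [ca ax] [cb bx] [K [cK K0 K1 Kx]]|b [cb bx]].
  + exists (g \o K); split=> [p|v|v|t v hv] /=.
    * by apply: continuous_comp; [exact: cK | exact: cg].
    * by rewrite K0 /= fK.
    * by rewrite K1 /= fK.
    * by rewrite Kx // fK.
  + exists (g \o b).
      split=> [v|v hv /=]; last by rewrite bx // fK.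
      by apply: continuous_comp; [exact: cb | exact: cg].
    exists (fun p => H (p.1, b p.2)); split=> //=.
    * exact: cHr.
    * by move=> t v hv; rewrite bx.
Qed.

(** * Clique complexes as spaces of finitely supported measures *)

Section clique_measures.
Context (R : realType).

(* Evaluation on all subsets, rather than on points only, makes pushforward
   along any map of vertices continuous, even for infinite [V]. *)
Definition discrete_measure (V : Type) (s : seq (V * R)) : {ptws set V -> R} :=
  fun B => \sum_(p <- s) p.2 * \1_B p.1.

Definition push (V V' : Type) (f : V -> V') (m : {ptws set V -> R}) :
  {ptws set V' -> R} := fun B => m (f @^-1` B).

Definition segment (V : Type) (t : R) (m m' : {ptws set V -> R}) :
  {ptws set V -> R} := fun B => (1 - t) * m B + t * m' B.

(* The geometric realization of the clique complex of the graph [c] on [A]. *)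
Definition cliques (V : choiceType) (c : V -> V -> Prop) (A : set V) :
    set {ptws set V -> R} :=
  [set m | exists s : seq (V * R),
     [/\ forall p, p \in s -> 0 <= p.2 /\ A p.1, \sum_(p <- s) p.2 = 1,
         forall p q, p \in s -> q \in s -> c p.1 q.1 &
         m = discrete_measure s]].

Lemma cliquesS (V : choiceType) (c c' : V -> V -> Prop) (A A' : set V) :
  (forall v w, c v w -> c' v w) -> A `<=` A' -> cliques c A `<=` cliques c' A'.
Proof.
move=> cc' AA' m [s [sA s1 sc ->]]; exists s; split=> //.
  by move=> p /sA[p0 /AA'].
by move=> p q ps qs; apply: cc'; exact: sc.
Qed.

Lemma push_discrete (V V' : Type) (f : V -> V') s :
  push f (discrete_measure s) = discrete_measure [seq (f p.1, p.2) | p <- s].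
Proof. by apply/funext => B; rewrite /push /discrete_measure big_map. Qed.

Lemma push_cliques (V V' : choiceType) (c : V -> V -> Prop)
    (c' : V' -> V' -> Prop) (A : set V) (A' : set V') (f : V -> V') :
  (forall v, A v -> A' (f v)) ->
  (forall v w, A v -> A w -> c v w -> c' (f v) (f w)) ->
  forall m, cliques c A m -> cliques c' A' (push f m).
Proof.
move=> fA fc m [s [sA s1 sc ->]]; exists [seq (f p.1, p.2) | p <- s]; split.
- by move=> _ /mapP[p /sA[p0 Ap] ->]; split=> //; exact: fA.
- by rewrite big_map.
- move=> _ _ /mapP[p ps ->] /mapP[q qs ->] /=.
  by apply: fc; [exact: (sA p ps).2 | exact: (sA q qs).2 | exact: sc].
- exact: push_discrete.
Qed.

Lemma push_id (V : choiceType) (c : V -> V -> Prop) (A : set V) (g : V -> V) m :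
  (forall v, A v -> g v = v) -> cliques c A m -> push g m = m.
Proof.
move=> gA [s [sA _ _ ->]]; apply/funext => B.
rewrite push_discrete /discrete_measure big_map !big_seq.
by apply: eq_bigr => p ps /=; rewrite gA //; exact: (sA p ps).2.
Qed.

(** The vertices listed are the old ones and their images under [g]. An old vertex is adjacent to an
    image by hypothesis, two images by a second use of it. *)
Lemma segment_cliques (V : choiceType) (c : V -> V -> Prop) (A : set V)
    (g : V -> V) (t : R) m :
  0 <= t <= 1 -> (forall v, A v -> A (g v)) ->
  (forall v w, c v w -> c w v) ->
  (forall v w, A v -> A w -> c v w -> c v (g w)) ->
  cliques c A m -> cliques c A (segment t (push g m) m).
Proof.
move=> /andP[t0 t1] gA cs cg [s [sA s1 sc ->]].
exists ([seq (g p.1, (1 - t) * p.2) | p <- s] ++ [seq (p.1, t * p.2) | p <- s]).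
have cgg v w : A v -> A w -> c v w -> c (g v) (g w).
  move=> Av Aw vw; apply: (cs); apply: (cg) => //; first exact: gA.
  exact/cs/cg.
split.
- move=> p; rewrite mem_cat => /orP[] /mapP[q /sA[q0 Aq] ->] /=; split=> //.
  + by rewrite mulr_ge0 // subr_ge0.
  + exact: gA.
  + by rewrite mulr_ge0.
- by rewrite big_cat !big_map /= -!mulr_sumr s1 !mulr1 subrK.
- move=> p q; rewrite !mem_cat.
  move=> /orP[] /mapP[p' p's ->] /orP[] /mapP[q' q's ->] /=;
    have [_ Ap] := sA _ p's; have [_ Aq] := sA _ q's.
  + by apply: cgg => //; exact: sc.
  + by apply: (cs); apply: cg => //; exact: sc.
  + by apply: cg => //; exact: sc.
  + exact: sc.
- apply/funext => B; rewrite /segment push_discrete /discrete_measure.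
  rewrite big_cat !big_map /= !mulr_sumr; congr (_ + _);
  by apply: eq_bigr => p _; rewrite mulrA.
Qed.

End clique_measures.

(** * Continuity for spaces of measures *)

Section continuity.
Context (R : realType).

Lemma continuous_into_sub (X U : topologicalType) (A : set U) (h : X -> A) :
  continuous (fun x => val (h x)) -> continuous h.
Proof.
by move=> ch; apply/continuousP => _ [W oW <-]; move/continuousP: ch => /(_ W oW).
Qed.

Lemma continuous_ptws (U : Type) (T : topologicalType) (h : T -> {ptws U -> R}) :
  (forall u, continuous (fun x => h x u)) -> continuous h.
Proof.
move=> ch x; apply/cvg_sup => u.
move: x; apply/(@continuousP _ (initial_topology (@^~ u))) => _ [B oB <-].
by move/continuousP: (ch u) => /(_ B oB).
Qed.

Lemma continuous_eval (U : eqType) (A : set {ptws U -> R}) (u : U) :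
  continuous (fun m : A => val m u).
Proof.
move=> m; apply: (@continuous_comp _ _ _ (val : A -> {ptws U -> R})
  (@proj U (fun=> R) u)); first exact: initial_continuous.
exact: proj_continuous.
Qed.

Lemma continuous_segment (V : eqType) (A : set {ptws set V -> R})
    (h : unit_interval R * A -> A) (k : A -> {ptws set V -> R}) :
  continuous k ->
  (forall p, val (h p) = segment (val p.1) (k p.2) (val p.2)) -> continuous h.
Proof.
move=> ck hE; apply: continuous_into_sub; rewrite (funext hE).
apply: continuous_ptws => B p; rewrite /segment.
have c1 : (fun q : unit_interval R * A => val q.1) @ p --> val p.1.
  apply: continuous_comp; first exact: cvg_fst.
  exact: initial_continuous.
have c2 : (fun q : unit_interval R * A => val q.2 B) @ p --> val p.2 B.
  apply: (@continuous_comp _ _ _ snd (fun m : A => val m B)).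
    exact: cvg_snd.
  exact: continuous_eval.
have c3 : (fun q : unit_interval R * A => k q.2 B) @ p --> k p.2 B.
  apply: (@continuous_comp _ _ _ snd (fun m : A => k m B)).
    exact: cvg_snd.
  apply: (@continuous_comp _ _ _ k (@proj (set V) (fun=> R) B)).
    exact: ck.
  exact: proj_continuous.
apply: cvgD; apply: cvgM => //.
by apply: cvgB => //; exact: cvg_cst.
Qed.

Lemma continuous_finsum (T : topologicalType) (I : finType) (h : I -> T -> R) :
  (forall i, continuous (h i)) -> continuous (fun x => \sum_i h i x).
Proof.
move=> ch x; apply: cvg_big => [|i _]; first exact: add_continuous.
exact: ch.
Qed.

End continuity.

Lemma unit_interval_bounds (R : realType) (t : unit_interval R) :
  0 <= val t <= 1.
Proof. by have := set_mem (valP t); rewrite /unit_interval /= in_itv. Qed.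

(** * Weak equivalences of clique filtrations induced by maps of vertices *)

Section clique_filtrations.
Context (R : realType) (P : Type) (le : rel P).

(* The last hypothesis keeps the straight line from [f \o g] to the identity
   inside the clique complex. *)
Lemma clique_weak_equivalence (V V' : choiceType)
    (c : P -> V -> V -> Prop) (A : P -> set V)
    (mA : forall x y, le x y -> cliques (R := R) (c x) (A x) `<=` cliques (c y) (A y))
    (c' : P -> V' -> V' -> Prop) (A' : P -> set V')
    (mA' : forall x y, le x y ->
      cliques (R := R) (c' x) (A' x) `<=` cliques (c' y) (A' y))
    (f : V -> V') (g : P -> V' -> V) :
  (forall a v, A a v -> A' a (f v)) ->
  (forall a w, A' a w -> A a (g a w)) ->
  (forall a v, A a v -> g a (f v) = v) ->
  (forall a v w, A a v -> A a w -> c a v w -> c' a (f v) (f w)) ->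
  (forall a v w, A' a v -> A' a w -> c' a v w -> c a (g a v) (g a w)) ->
  (forall a v w, c' a v w -> c' a w v) ->
  (forall a v w, A' a v -> A' a w -> c' a v w -> c' a v (f (g a w))) ->
  objectwise_weak_equivalence R (filtration mA) (filtration mA').
Proof.
move=> fA gA fK fc gc cs cfg.
pose eta a (m : cliques (R := R) (c a) (A a)) : cliques (c' a) (A' a) :=
  exist _ (push f (val m))
    (mem_set (push_cliques (fA a) (@fc a) (set_mem (valP m)))).
(* [f] is the same at all grades, so pushforward along it is natural; [g a] only serves at the grade
   [a]. *)
exists eta; split=> [a b h m|a]; first exact: val_inj.
pose rho (m : cliques (R := R) (c' a) (A' a)) : cliques (c a) (A a) :=
  exist _ (push (g a) (val m))
    (mem_set (push_cliques (gA a) (@gc a) (set_mem (valP m)))).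
have fgA v : A' a v -> A' a (f (g a v)) by move=> Av; exact: fA (gA _ _ Av).
pose H (p : unit_interval R * cliques (R := R) (c' a) (A' a)) :
    cliques (c' a) (A' a) :=
  exist _ (segment (val p.1) (push (f \o g a) (val p.2)) (val p.2))
    (mem_set (segment_cliques (unit_interval_bounds p.1) fgA (@cs a) (@cfg a)
      (set_mem (valP p.2)))).
have cpush (W W' : choiceType) (h : W -> W') (B : set {ptws set W -> R}) :
    continuous (fun m : B => push h (val m)).
  by apply: continuous_ptws => C; exact: continuous_eval.
have fgK m : cliques (R := R) (c a) (A a) m -> push (g a) (push f m) = m.
  by move=> cm; exact: push_id (fK a) cm.
apply: (@deformation_retract_weak_equivalence _ _ _ _ rho H).
- exact/continuous_into_sub/cpush.
- exact/continuous_into_sub/cpush.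
- apply: (@continuous_segment _ _ _ _ (fun m => push (f \o g a) (val m))) => //.
  exact: cpush.
- by move=> m; apply: val_inj; apply: fgK; exact: set_mem (valP m).
- move=> m; apply: val_inj; apply/funext => B /=.
  by rewrite /segment subr0 mul1r mul0r addr0.
- move=> m; apply: val_inj; apply/funext => B /=.
  by rewrite /segment subrr mul0r mul1r add0r.
(* On the image of [f] both ends of the segment agree, as [g a] undoes [f] on the vertices in
   [A a]. *)
- move=> t m; apply: val_inj; apply/funext => B /=; rewrite /segment.
  have -> : push (f \o g a) (push f (val m)) B = push f (val m) B.
    by rewrite -[in RHS](fgK _ (set_mem (valP m))).
  by rewrite -mulrDl subrK mul1r.
Qed.

End clique_filtrations.

(** * Subdivisions as clique complexes *)

Section subdivision.
Context (R : realType) (I : finType).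

Definition nested (s t : {set I}) : Prop := (s \subset t) || (t \subset s).

Definition large_faces (T : scomplex I) (k : R) : set {set I} :=
  [set s | s \in T /\ k <= #|s|%:R].

(** Every member of a flag contains its minimum, so the bound on the size of the minimum holds for
    all members: the subdivision is the clique complex of [nested] on [large_faces T k]. *)
Lemma subdivP (T : scomplex I) (k : R) (F : {set {set I}}) :
  F \in subdiv T k <->
  [/\ F != finset.set0, forall s, s \in F -> large_faces T k s &
      forall s t, s \in F -> t \in F -> nested s t].
Proof.
have dimE (s : {set I}) : (k - 1 <= (simplex_dim s)%:~R) = (k <= #|s|%:R).
  by rewrite /simplex_dim rmorphB /= lerD2r.
rewrite inE; split=> [/and3P[FT chF]|[F0 FT chF]].
- move=> /exists_inP[s sF /andP[/forall_inP smin]]; rewrite dimE => ks.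
  split; first by apply/set0Pn; exists s.
  + move=> t tF; split; first exact: (fintype.subsetP FT).
    by apply: le_trans ks _; rewrite ler_nat subset_leq_card // smin.
  + by move=> u v uF vF; exact: (forall_inP (forall_inP chF _ uF) _ vF).
- have chF' : [forall s in F, forall t in F, (s \subset t) || (t \subset s)].
    by apply/forall_inP => s sF; apply/forall_inP => t tF; exact: chF.
  apply/and3P; split=> //.
    by apply/fintype.subsetP => s /FT[].
  have [s sF smin] := chain_min F0 chF'.
  apply/exists_inP; exists s => //; rewrite dimE (FT _ sF).2 andbT.
  by apply/forall_inP.
Qed.

(** Barycentric coordinates become the weights of point masses; they are recovered as the masses of
    singletons. *)
Definition measure_of (t : {ptws {set I} -> R}) : {ptws set {set I} -> R} :=
  discrete_measure [seq (s, t s) | s <- enum {set I}].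

Lemma measure_ofE t B : measure_of t B = \sum_s t s * \1_B s.
Proof. by rewrite /measure_of /discrete_measure big_map big_enum. Qed.

Lemma measure_of_set1 t s : measure_of t [set s] = t s.
Proof.
rewrite measure_ofE (bigD1 s) //= indicE mem_set // mulr1 big1 ?addr0 // => u us.
by rewrite indicE memNset ?mulr0 //= => su; rewrite su eqxx in us.
Qed.

Lemma measure_of_cliques (T : scomplex I) (k : R) t :
  realization R (subdiv T k) t -> cliques nested (large_faces T k) (measure_of t).
Proof.
move=> [t0 t1 /subdivP[_ tT tc]].
(* The clique condition also applies to entries of weight zero, so only the support is listed. *)
exists [seq (s, t s) | s <- enum {set I} & t s != 0].
have memE p : p \in [seq (s, t s) | s <- enum {set I} & t s != 0] ->
    p = (p.1, t p.1) /\ p.1 \in [set s | t s != 0]%SET.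
  by move=> /mapP[s]; rewrite mem_filter inE => /andP[ts _] ->; rewrite /= ts.
split.
- by move=> p /memE[-> ps] /=; split; [exact: t0 | exact: tT].
- rewrite big_map big_filter big_enum_cond /= -[RHS]t1.
  rewrite [RHS](bigID (fun s => t s != 0)) /=.
  by rewrite [X in _ = _ + X]big1 ?addr0 // => s /negPn/eqP.
- by move=> p q /memE[_ ps] /memE[_ qs]; exact: tc.
- apply/funext => B; rewrite measure_ofE /discrete_measure big_map big_filter.
  rewrite big_enum_cond /= (bigID (fun s => t s != 0)) /=.
  by rewrite [X in _ + X = _]big1 ?addr0 // => s /negPn/eqP ->; rewrite mul0r.
Qed.

(** On a finite set these measures are determined by their values on singletons. A list may repeat a
    vertex, but a singleton of non-zero mass always comes from a listed vertex, which gives the flag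
    condition. *)
Lemma realization_of_cliques (T : scomplex I) (k : R) m :
  cliques nested (large_faces T k) m ->
  realization R (subdiv T k) (fun s => m [set s]) /\
  measure_of (fun s => m [set s]) = m.
Proof.
move=> [S [SA S1 Sc ->]].
have sumE B : \sum_s discrete_measure S [set s] * \1_B s = discrete_measure S B.
  rewrite /discrete_measure; under eq_bigr do rewrite mulr_suml.
  rewrite exchange_big /=; apply: eq_bigr => p _.
  rewrite (bigD1 p.1) //= [\1_[set _] _]indicE mem_set // mulr1.
  rewrite big1 ?addr0 // => s sp.
  by rewrite [\1_[set _] _]indicE memNset ?mulr0 ?mul0r //= => /esym/eqP;
    rewrite (negbTE sp).
split; last by apply/funext => B; rewrite measure_ofE sumE.
have suppS s : discrete_measure S [set s] != 0 -> exists2 p, p \in S & p.1 = s.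
  move=> /eqP ms; apply: contrapT => nS; apply: ms.
  rewrite /discrete_measure big_seq big1 // => p pS.
  by rewrite indicE memNset ?mulr0 //= => ps; apply: nS; exists p.
have sum1 : \sum_s discrete_measure S [set s] = 1.
  rewrite -[RHS]S1 -[RHS](_ : discrete_measure S setT = _).
    by rewrite -sumE; apply: eq_bigr => s _; rewrite indicE mem_set // mulr1.
  by apply: eq_bigr => p _; rewrite indicE mem_set // mulr1.
split=> //.
- move=> s; rewrite /discrete_measure big_seq; apply: sumr_ge0 => p pS.
  by rewrite mulr_ge0 ?(SA p pS).1 // indicE.
- apply/subdivP; split.
  + apply/set0Pn; apply: contrapT => nS.
    have := sum1; rewrite big1 => [/esym/eqP|s _]; first by rewrite oner_eq0.
    by apply/eqP/negPn/negP => ms; apply: nS; exists s; rewrite inE.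
  + by move=> s; rewrite inE => /suppS[p /SA[_ ?] <-].
  + move=> s t; rewrite !inE => /suppS[p pS <-] /suppS[q qS <-]; exact: Sc.
Qed.

(** Each component is a homeomorphism, that is, a deformation retract along the constant homotopy
    [snd]. *)
Lemma subdiv_weak_equivalence (P : Type) (le : rel P) (T : P -> scomplex I)
    (k : P -> R)
    (mT : forall x y, le x y ->
      realization R (subdiv (T x) (k x)) `<=` realization R (subdiv (T y) (k y)))
    (mA : forall x y, le x y -> cliques (R := R) nested (large_faces (T x) (k x))
      `<=` cliques nested (large_faces (T y) (k y))) :
  objectwise_weak_equivalence R (filtration mT) (filtration mA).
Proof.
pose eta a (t : realization R (subdiv (T a) (k a))) :
    cliques (R := R) nested (large_faces (T a) (k a)) :=
  exist _ (measure_of (val t)) (mem_set (measure_of_cliques (set_mem (valP t)))).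
exists eta; split=> [a b h t|a]; first exact: val_inj.
pose rho (m : cliques (R := R) nested (large_faces (T a) (k a))) :
    realization R (subdiv (T a) (k a)) :=
  exist _ (fun s => val m [set s])
    (mem_set (realization_of_cliques (set_mem (valP m))).1).
have rhoK m : eta a (rho m) = m.
  by apply: val_inj; exact: (realization_of_cliques (set_mem (valP m))).2.
apply: (@deformation_retract_weak_equivalence _ _ _ _ rho snd).
- apply: continuous_into_sub; apply: continuous_ptws => B.
  suff -> : (fun t => val (eta a t) B) = (fun t => \sum_s val t s * \1_B s).
    apply: continuous_finsum => s t.
    exact: cvgM (@continuous_eval _ _ (realization R _) s t) (cvg_cst _).
  by apply/funext => t; exact: measure_ofE.
- by apply: continuous_into_sub; apply: continuous_ptws => s; exact: continuous_eval.
- by move=> p; exact: cvg_snd.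
- by move=> t; apply: val_inj; apply/funext => s; exact: measure_of_set1.
- by move=> m; rewrite rhoK.
- by [].
- by [].
Qed.

End subdivision.

(** * Data points against centres, for an abstract relation [near] *)

Section centres.
Context (R : realType) (W C : Type) (near : C -> R -> W -> Prop).
Hypothesis nearS : forall c r r' w, r <= r' -> near c r w -> near c r' w.

Definition common_centres (I : finType) (f : I -> W) (r : R) (s : {set I}) :
    set C := [set c | forall x, x \in s -> near c r (f x)].

Definition common_points (I : finType) (f : I -> W) (r : R) (D : set C) :
    {set I} := [set x | `[< forall c, D c -> near c r (f x) >]]%SET.

Section galois.
Context (I : finType) (f : I -> W).

Lemma galois r (s : {set I}) (D : set C) :
  s \subset common_points f r D <-> D `<=` common_centres f r s.
Proof.
split=> [/fintype.subsetP sS c Sc x /sS|sS].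
  by rewrite inE => /asboolP; exact.
apply/fintype.subsetP => x xs; rewrite inE; apply/asboolP => c /sS; exact.
Qed.

Lemma common_pointsS r r' (D D' : set C) : r <= r' -> D' `<=` D ->
  common_points f r D \subset common_points f r' D'.
Proof.
move=> rr' SS; apply/fintype.subsetP => x; rewrite !inE => /asboolP Sx.
by apply/asboolP => c /SS/Sx; exact: nearS.
Qed.

Lemma common_centresS r (s s' : {set I}) : s' \subset s ->
  common_centres f r s `<=` common_centres f r s'.
Proof. by move=> /fintype.subsetP ss c sc x /ss; exact: sc. Qed.

Local Notation vertex := ({set I} + set C)%type.

(** The symmetrised order of the glued poset, so that cliques are chains. All grades share one type
    of vertices; only the relation between the two kinds depends on [r], and it grows with [r]. *)
Definition comparable (r : R) (v w : vertex) : Prop :=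
  match v, w with
  | inl s, inl t => nested s t
  | inr D, inr D' => D `<=` D' \/ D' `<=` D
  | inl s, inr D | inr D, inl s => s \subset common_points f r D
  end.

Lemma comparable_sym r (v w : vertex) : comparable r v w -> comparable r w v.
Proof.
case: v w => [s|D] [t|D'] //=; first by rewrite /nested orbC.
by case; [right | left].
Qed.

Lemma comparableS r r' (v w : vertex) : r <= r' -> comparable r v w -> comparable r' v w.
Proof.
move=> rr'; case: v w => [s|D] [t|D'] //= /fintype.subset_trans; apply;
exact: common_pointsS.
Qed.

(** With [a] = (k, r), this is P(k, r) of the opening comment, and [central a] is Q(k, r). *)
Definition centred (a : J R) : set {set I} :=
  [set s : {set I} |
    (val a).1 * #|I|%:R <= #|s|%:R /\ common_centres f (val a).2 s !=set0].

Definition central (a : J R) : set (set C) :=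
  [set D : set C |
    (val a).1 * #|I|%:R <= #|common_points f (val a).2 D|%:R /\ D !=set0].

Lemma centredS a b : J_le a b -> centred a `<=` centred b.
Proof.
move=> /andP[kk' rr'] s [ks [c sc]]; split.
  by apply: le_trans ks; rewrite ler_wpM2r.
by exists c => x /sc; exact: nearS.
Qed.

Lemma centralS a b : J_le a b -> central a `<=` central b.
Proof.
move=> /andP[kk' rr'] D [kS S0]; split=> //.
apply: (@le_trans _ _ ((val a).1 * #|I|%:R)); first by rewrite ler_wpM2r.
by apply: le_trans kS _; rewrite ler_nat subset_leq_card // common_pointsS.
Qed.

Lemma central_centres a (s : {set I}) :
  centred a s -> central a (common_centres f (val a).2 s).
Proof.
move=> [ks s0]; split=> //; apply: le_trans ks _.
by rewrite ler_nat; apply: subset_leq_card; exact/galois.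
Qed.

Lemma centred_points a (D : set C) :
  central a D -> centred a (common_points f (val a).2 D).
Proof.
move=> [kS [c Sc]]; split=> //; exists c.
have /galois : common_points f (val a).2 D \subset common_points f (val a).2 D by [].
exact.
Qed.

(* The two parameters allow the vertices of either kind to be removed one layer
   at a time, each layer by a straight-line deformation. *)
Definition stage (m n : nat) (a : J R) : set vertex :=
  [set v | match v with
           | inl s => centred a s /\ (#|s| <= m)%N
           | inr D => central a D /\ (n <= #|common_points f (val a).2 D|)%N
           end].

Lemma stageS m n a b : J_le a b -> stage m n a `<=` stage m n b.
Proof.
move=> ab [s|D] [vA vn]; first by split=> //; exact: centredS ab _ vA.
split; first exact: centralS ab _ vA.
apply: leq_trans vn _; apply: subset_leq_card; apply: common_pointsS => //.
by case/andP: ab.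
Qed.

Lemma stage_cliquesS m n a b : J_le a b ->
  cliques (R := R) (comparable (val a).2) (stage m n a) `<=`
  cliques (comparable (val b).2) (stage m n b).
Proof.
move=> ab; apply: cliquesS; last exact: stageS.
by move=> v w; apply: comparableS; case/andP: ab.
Qed.

Definition stage_filtration m n : bifiltration R :=
  filtration (@stage_cliquesS m n).

(** A set of the top size [m.+1] moves to its set of common centres. What is comparable with it is
    either one of its subsets, which has all these centres too, or a set of centres, which is then
    contained in that set. *)
Lemma remove_centred m :
  objectwise_weak_equivalence R (stage_filtration m 0) (stage_filtration m.+1 0).
Proof.
pose g (a : J R) (v : vertex) : vertex :=
  match v with
  | inl s => if (#|s| <= m)%N then v else inr (common_centres f (val a).2 s)
  | inr _ => v
  end.
have gA a v : stage m.+1 0 a v -> stage m 0 a (g a v).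
  case: v => [s|D] //= [sA sm]; case: ifP => // _.
  by split=> //; exact: central_centres.
have sA a v : stage m 0 a v -> stage m.+1 0 a v.
  by case: v => [s|D] //= [? /leqW ?].
have cg a v w : stage m.+1 0 a v -> stage m.+1 0 a w ->
    comparable (val a).2 v w -> comparable (val a).2 v (g a w).
  case: w => [t|//] Av [_ tm] /=; case: ifPn => //; rewrite -ltnNge => mt.
  case: v Av => [s|D] /= [_ sm]; last by move=> /galois; left.
  move=> st; apply/galois; apply: common_centresS.
  case/orP: st => // ts; suff -> : t = s by [].
  by apply/eqP; rewrite eqEcard ts (leq_trans sm).
apply: (@clique_weak_equivalence _ _ _ _ _ _ _ _ _ _ _ id g) => //.
- by move=> a [s|D] //= [_ ->].
- move=> a v w Av Aw vw; apply/comparable_sym/(cg) => //; first exact/sA/gA.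
  exact/comparable_sym/cg.
- by move=> a v w; exact: comparable_sym.
Qed.

(** Dually, a set of centres with exactly [n] common points moves to the set of these points. A
    larger set of centres at this stage cannot have fewer common points, so it has the same ones. *)
Lemma remove_central n :
  objectwise_weak_equivalence R (stage_filtration #|I| n.+1)
    (stage_filtration #|I| n).
Proof.
pose g (a : J R) (v : vertex) : vertex :=
  match v with
  | inl _ => v
  | inr D => let s := common_points f (val a).2 D in
             if (n < #|s|)%N then v else inl s
  end.
have gA a v : stage #|I| n a v -> stage #|I| n.+1 a (g a v).
  case: v => [s|D] //= [SA Sn]; case: ifP => // _.
  by split; [exact: centred_points | exact: max_card].
have sA a v : stage #|I| n.+1 a v -> stage #|I| n a v.
  by case: v => [s|D] //= [? /ltnW ?].
have cg a v w : stage #|I| n a v -> stage #|I| n a w ->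
    comparable (val a).2 v w -> comparable (val a).2 v (g a w).
  case: w => [//|D] Av [_ Sn] /=; case: ifPn => //; rewrite -leqNgt => nS.
  case: v Av => [s|D'] /= [_ D'n]; first by rewrite /nested => ->.
  case=> DD'; first exact: common_pointsS.
  suff -> : common_points f (val a).2 D = common_points f (val a).2 D' by [].
  apply/eqP; rewrite eq_sym eqEcard common_pointsS //=.
  exact: leq_trans nS D'n.
apply: (@clique_weak_equivalence _ _ _ _ _ _ _ _ _ _ _ id g) => //.
- by move=> a [s|D] //= [_ ->].
- move=> a v w Av Aw vw; apply/comparable_sym/(cg) => //; first exact/sA/gA.
  exact/comparable_sym/cg.
- by move=> a v w; exact: comparable_sym.
Qed.

Definition included (D D' : set C) : Prop := D `<=` D' \/ D' `<=` D.

Lemma central_cliquesS a b : J_le a b ->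
  cliques (R := R) included (central a) `<=` cliques included (central b).
Proof. by move=> ab; apply: cliquesS => //; exact: centralS. Qed.

Lemma centred_cliquesS a b : J_le a b ->
  cliques (R := R) (@nested I) (centred a) `<=` cliques (@nested I) (centred b).
Proof. by move=> ab; apply: cliquesS => //; exact: centredS. Qed.

Hypothesis I_gt0 : (0 < #|I|)%N.

Lemma centred_card_gt0 a (s : {set I}) : centred a s -> (0 < #|s|)%N.
Proof.
move=> [ks _]; rewrite -(ltr_nat R); apply: lt_le_trans ks.
by rewrite mulr_gt0 ?ltr0n //; case/andP: (valP a).
Qed.

(** [stage #|I| #|I|.+1] contains no sets of centres, since no set has more than [#|I|] common
    points; [stage #|I| 0] is the whole glued poset; [stage 0 0] contains no sets of data points,
    since centred sets are non-empty. *)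
Lemma centred_central :
  weakly_equivalent R (filtration centred_cliquesS) (filtration central_cliquesS).
Proof.
have down n : weakly_equivalent R (stage_filtration #|I| n) (stage_filtration #|I| 0).
  elim: n => [|n IHn]; first exact: rst_refl.
  exact: rst_trans (rst_step _ _ _ _ (remove_central n)) IHn.
have up m : weakly_equivalent R (stage_filtration 0 0) (stage_filtration m 0).
  elim: m => [|m IHm]; first exact: rst_refl.
  exact: rst_trans IHm (rst_step _ _ _ _ (remove_centred m)).
apply: (rst_trans _ _ _ (stage_filtration #|I| #|I|.+1)); last first.
  apply: rst_trans (down _) _.
  apply: (rst_trans _ _ _ (stage_filtration 0 0)); first exact: rst_sym (up _).
  apply/rst_sym/rst_step.
  (* The default value is never met: by [no_inl] no vertex at this stage is of the form [inl s]. *)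
  pose g (a : J R) (v : vertex) := if v is inr D then D else set0.
  have no_inl a (s : {set I}) : ~ stage 0 0 a (inl s).
    by move=> [/centred_card_gt0 s0]; rewrite leqNgt s0.
  apply: (@clique_weak_equivalence _ _ _ _ _ _ _ _ _ _ _ inr g) => //=.
  - by move=> a [s /no_inl|D [DA _]].
  - by move=> a [s|D] [t|D'] => [/no_inl|/no_inl|_ /no_inl|].
  - by move=> a v w; exact: comparable_sym.
  - by move=> a v [s|D'] => [_ /no_inl|].
apply: rst_step.
pose g (a : J R) (v : vertex) := if v is inl s then s else finset.set0.
have no_inr a (D : set C) : ~ stage #|I| #|I|.+1 a (inr D).
  by move=> [_ /leq_trans/(_ (max_card _))]; rewrite ltnn.
apply: (@clique_weak_equivalence _ _ _ _ _ _ _ _ _ _ _ inl g) => //=.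
- by move=> a s sA; split=> //; exact: max_card.
- by move=> a [s [sA _]|D /no_inr].
- by move=> a [s|D] [t|D'] => [|_ /no_inr|/no_inr|/no_inr].
- by move=> a v w; exact: comparable_sym.
- by move=> a v [s|D'] => [|_ /no_inr].
Qed.

End galois.
End centres.

(** * Interleavings by inclusions *)

Lemma top_functor_irr (P : Type) (le : rel P) (F : P -> topologicalType)
    (u : forall x y, le x y -> F x -> F y) c c' i i' m m' :
  @TopFunctor P le F u c i m = @TopFunctor P le F u c' i' m'.
Proof.
by rewrite (Prop_irrelevance c c') (Prop_irrelevance i i') (Prop_irrelevance m m').
Qed.

(** In one ambient space the two families form a single filtration indexed by [J R * bool], whose
    maps across are the given inclusions. *)
Lemma filtration_interleaved (R : realType) (gamma kappa : forward_shift R)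
    (U : topologicalType) (A B : J R -> set U)
    (mA : forall x y, J_le x y -> A x `<=` A y)
    (mB : forall x y, J_le x y -> B x `<=` B y) :
  (forall a b, grade_le (gamma (val a)) (val b) -> A a `<=` B b) ->
  (forall a b, grade_le (kappa (val a)) (val b) -> B a `<=` A b) ->
  interleaved gamma kappa (filtration mA) (filtration mB).
Proof.
move=> AB BA; pose AorB (p : J R * bool) := if p.2 then B p.1 else A p.1.
have mAB p q : interleaving_le gamma kappa p q -> AorB p `<=` AorB q.
  case: p q => [a [] [b []]]; [exact: mB | exact: BA | exact: AB | exact: mA].
(* [interleaved] requires equal functors, not just isomorphic ones; the two sides here differ only
   in proofs. *)
have pre i : tf_precomp (@interleaving_le_pair _ gamma kappa i) (filtration mAB) =
    filtration (fun x y h => mAB _ _ (@interleaving_le_pair _ gamma kappa i x y h)).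
  exact: top_functor_irr.
exists (filtration mAB); split; rewrite pre.
- by rewrite (Prop_irrelevance mA
    (fun x y h => mAB _ _ (interleaving_le_pair _ _ false h))).
- by rewrite (Prop_irrelevance mB
    (fun x y h => mAB _ _ (interleaving_le_pair _ _ true h))).
Qed.

(** * The Prohorov distance of uniform measures *)

Section unif_comparison.
Context (R : realType) (W : metricType R) (I I' : finType).
Context (f : I -> W) (f' : I' -> W).

Definition unif_le (d : R) : Prop := forall A, closed A ->
  (unif R f A <= unif R f' (thickening A d) + d%:E)%E.

Lemma unifS (A B : set W) : A `<=` B -> (unif R f A <= unif R f B)%E.
Proof.
move=> AB; rewrite lee_fin ler_wpM2r // ler_nat; apply: subset_leq_card.
by apply/fintype.subsetP => i; rewrite !inE; exact: AB.
Qed.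

Context (C : Type) (near : C -> R -> W -> Prop).

(** The images under [f] of the common points of [D] form a finite, hence closed, set of mass at
    least k. The points of the other data set in its thickening are common points of [D] at radius r
    + d, and they have mass at least k - d. *)
Lemma central_shift (d : {nonneg R}) (a b : J R) :
  (0 < #|I|)%N -> (0 < #|I'|)%N ->
  (forall c r r' w, r <= r' -> near c r w -> near c r' w) ->
  (forall c r w w', near c r w -> mdist w' w < d%:num -> near c (r + d%:num) w') ->
  unif_le d%:num -> grade_le (tau d (val a)) (val b) ->
  central near f a `<=` central near f' b.
Proof.
move=> I0 I'0 nearS near_shift ff' /andP[/= kk' rr'] D [kD D0]; split=> //.
pose A := f @` [set` common_points near f (val a).2 D].
have cA : closed A.
  have /accessible_finite_set_closed : accessible_space W.
    exact/hausdorff_accessible/metric_hausdorff.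
  by apply; exact/finite_image/finite_finset.
have := ff' _ cA; rewrite -EFinD lee_fin => A_le.
have k_le : (val a).1 <= #|[pred i | f i \in A]|%:R / #|I|%:R.
  rewrite ler_pdivlMr ?ltr0n //; apply: le_trans kD _; rewrite ler_nat.
  apply: subset_leq_card; apply/fintype.subsetP => x xD.
  by rewrite !inE; exists x.
have le_k : #|[pred i | f' i \in thickening A d%:num]|%:R / #|I'|%:R <=
    #|common_points near f' (val b).2 D|%:R / #|I'|%:R :> R.
  rewrite ler_wpM2r // ler_nat; apply: subset_leq_card.
  apply/fintype.subsetP => x'; rewrite !inE => -[_ [x xD <-] xx'].
  apply/asboolP => c Dc; apply: nearS rr' _; apply: near_shift xx'.
  by move: xD; rewrite /= inE => /asboolP; exact.
rewrite -ler_pdivlMr ?ltr0n //; apply: le_trans kk' _.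
by rewrite lerBlDr (le_trans k_le) // (le_trans A_le) // lerD2r.
Qed.

End unif_comparison.

(** [prohorov] takes an infimum for each closed set separately. A number [d] above the supremum
    exceeds all these infima, and thickenings grow with the radius, so [d] meets the conditions for
    all closed sets at once. *)
Lemma prohorov_bound (R : realType) (W : metricType R) (I I' : finType)
    (f : I -> W) (f' : I' -> W) (m m' : borel_measure R W) (x : \bar R) :
  m =1 unif R f -> m' =1 unif R f' ->
  (forall d : {nonneg R}, unif_le f f' d%:num -> unif_le f' f d%:num ->
    (x <= d%:num%:E)%E) ->
  (x <= prohorov m m')%E.
Proof.
move=> mE m'E xle.
have thickS (A : set W) d d' : d <= d' -> thickening A d `<=` thickening A d'.
  by move=> dd' z [a Aa /lt_le_trans za]; exists a => //; exact: za.
have key (d : R) : (prohorov m m' < d%:E)%E -> 0 <= d /\ (x <= d%:E)%E.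
  move=> pd; have key A : closed A -> exists2 d', 0 <= d' < d &
      (unif R f A <= unif R f' (thickening A d') + d'%:E)%E /\
      (unif R f' A <= unif R f (thickening A d') + d'%:E)%E.
    move=> cA; have : (ereal_inf [set d%:E | d in [set d : R |
      [/\ (0 <= d)%R, (m A <= m' (thickening A d) + d%:E)%E &
          (m' A <= m (thickening A d) + d%:E)%E]]] < d%:E)%E.
      by apply: le_lt_trans pd; apply: ereal_sup_ubound; exists A.
    move=> /ereal_inf_lt[_ [d' [d'0 mA m'A] <-]]; rewrite lte_fin => d'd.
    by exists d'; [rewrite d'0 | rewrite -!mE -!m'E].
  (* The empty set is closed, which provides some [d'] with 0 <= [d'] < [d]. *)
  have d0 : 0 <= d.
    have [d' /andP[d'0 d'd] _] := key _ closed0.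
    exact: le_trans d'0 (ltW d'd).
  split=> //; apply: (xle (NngNum d0)) => A /key[d' /andP[_ /ltW d'd] [fA f'A]] /=.
    apply: le_trans fA _; apply: leeD; last by rewrite lee_fin.
    exact/unifS/thickS.
  apply: le_trans f'A _; apply: leeD; last by rewrite lee_fin.
  exact/unifS/thickS.
(* A finite distance is approached from above; [-oo] is impossible, as -1 would then be
   non-negative. *)
case: (prohorov m m') key => [p||] key.
- by apply/lee_addgt0Pr => e e0; apply: (key _ _).2; rewrite lte_fin ltrDl.
- exact: leey.
- by have [] := key (-1) (ltNyr _); rewrite ler0N1.
Qed.

(** Both filtrations are replaced by the order complexes of their central sets. These lie in the
    same space of measures on [set C], where [central_shift] gives plain inclusions. *)
Lemma subdiv_homotopy_interleaved (R : realType) (W : metricType R)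
    (I I' : finType) (f : I -> W) (f' : I' -> W)
    (C : Type) (near : C -> R -> W -> Prop) (d : {nonneg R})
    (T : J R -> scomplex I) (T' : J R -> scomplex I')
    (k k' : J R -> R)
    (mT : forall x y, J_le x y ->
      realization R (subdiv (T x) (k x)) `<=` realization R (subdiv (T y) (k y)))
    (mT' : forall x y, J_le x y ->
      realization R (subdiv (T' x) (k' x)) `<=` realization R (subdiv (T' y) (k' y))) :
  (0 < #|I|)%N -> (0 < #|I'|)%N ->
  (forall c r r' w, r <= r' -> near c r w -> near c r' w) ->
  (forall c r w w', near c r w -> mdist w' w < d%:num -> near c (r + d%:num) w') ->
  (forall a, large_faces (T a) (k a) = centred near f a) ->
  (forall a, large_faces (T' a) (k' a) = centred near f' a) ->
  unif_le f f' d%:num -> unif_le f' f d%:num ->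
  homotopy_interleaved (tau d) (tau d) (filtration mT) (filtration mT').
Proof.
move=> I0 I'0 nearS near_shift TE T'E ff' f'f.
have equiv (K : finType) (h : K -> W) (S : J R -> scomplex K) (l : J R -> R)
    (mS : forall x y, J_le x y ->
      realization R (subdiv (S x) (l x)) `<=` realization R (subdiv (S y) (l y))) :
    (0 < #|K|)%N -> (forall a, large_faces (S a) (l a) = centred near h a) ->
    weakly_equivalent R (filtration (central_cliquesS nearS (f := h))) (filtration mS).
  move=> K0 SE; apply: rst_sym.
  apply: rst_trans (centred_central nearS h K0).
  apply: rst_step; move: (@centred_cliquesS _ _ _ _ nearS _ h).
  rewrite -(funext SE) => mA; exact: subdiv_weak_equivalence.
exists (filtration (central_cliquesS nearS (f := f))),
  (filtration (central_cliquesS nearS (f := f'))).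
split; [exact: equiv | exact: equiv | apply: filtration_interleaved].
- by move=> a b ab; apply: cliquesS => //; exact: central_shift ab.
- by move=> a b ab; apply: cliquesS => //; exact: central_shift ab.
Qed.

(** * Multicover and Cech bifiltrations: the centres are the points of the space *)

Section cech.
Context (R : realType) (Z : metricType R).

Definition in_ball (c : Z) (r : R) (w : Z) : Prop := mdist w c < r.

Lemma in_ballS c r r' w : r <= r' -> in_ball c r w -> in_ball c r' w.
Proof. by move=> rr' /lt_le_trans; exact. Qed.

Lemma in_ball_shift (d : R) c r w w' :
  in_ball c r w -> mdist w' w < d -> in_ball c (r + d) w'.
Proof.
move=> cw ww'; apply: le_lt_trans (metric_triangle w' w c) _.
by rewrite addrC ltrD.
Qed.

Lemma fset_card_gt0 (X : {fset Z}) : X != fset0 -> (0 < #|{: X}|)%N.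
Proof. by rewrite -cardfE cardfs_gt0. Qed.

(** The common points of [[set y]] are the data points in the ball around [y], so their proportion
    is the measure of the ball. *)
Lemma multicover_central (X : {fset Z}) (a : J R) : X != fset0 ->
  multicover_set X a = [set y | central in_ball (fun x : X => val x) a [set y]].
Proof.
move=> X0; have cX : 0 < #|{: X}|%:R :> R by rewrite ltr0n fset_card_gt0.
have nuE (y : Z) : nu X (ball y (val a).2) =
    (#|common_points in_ball (fun x : X => val x) (val a).2 [set y]|%:R /
     #|{: X}|%:R)%:E.
  congr (_%:R / _)%:E; apply: eq_card => x; rewrite !inE ballEmdist /=.
  apply/idP/asboolP => [/set_mem xy _ -> |/(_ y erefl) xy].
    by rewrite /in_ball metric_sym.
  by apply/mem_set; rewrite /= metric_sym.
have multicoverE y : multicover_set X a y <-> (val a).1 * #|{: X}|%:R <=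
    #|common_points in_ball (fun x : X => val x) (val a).2 [set y]|%:R.
  by rewrite -ler_pdivlMr // -lee_fin -nuE.
apply/seteqP; split=> y; first by move=> /multicoverE ky; split=> //; exists y.
by case=> /multicoverE.
Qed.

(** Common centres of [s] are the points lying in all balls around [s]. The empty set, of which
    every point is a common centre, is excluded by k|X| > 0. *)
Lemma cech_centred (X : {fset Z}) (a : J R) : X != fset0 ->
  large_faces (cech X (val a).2) ((val a).1 * #|` X|%:R) =
  centred in_ball (fun x : X => val x) a.
Proof.
move=> X0; have a1 : 0 < (val a).1 by case/andP: (valP a).
apply/seteqP; split=> s; rewrite /large_faces /centred /= cardfE inE.
- move=> [/andP[_ /asboolP[z zs]] ks]; split=> //; exists z => x /zs.
  by rewrite ballEmdist.
- move=> [ks [z sz]]; split=> //; apply/andP; split.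
    rewrite -card_gt0 -(ltr_nat R); apply: lt_le_trans ks.
    by rewrite mulr_gt0 // ltr0n fset_card_gt0.
  by apply/asboolP; exists z => x /sz; rewrite ballEmdist.
Qed.

End cech.

(** * Rips bifiltrations: the centres are sets of bounded diameter *)

Section rips.
Context (R : realType) (W : metricType R).

(* Sets of diameter less than [2 * rho], each thought of as the centre of a ball
   of radius [rho] containing it: in place of the points of an injective
   envelope of [W], in which Rips complexes are Cech complexes. *)
Definition rips_centre : Type :=
  {c : set W * R | forall x y, c.1 x -> c.1 y -> mdist x y < 2 * c.2}.

(** The distance from [w] to the imagined centre is estimated by passing through a point [x] of the
    set. The inequality is not strict: strictness is already in the bound on the diameter. *)
Definition near_rips (c : rips_centre) (r : R) (w : W) : Prop :=
  exists2 x, (sval c).1 x & (sval c).2 + mdist w x <= r.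

Lemma near_ripsS c r r' w : r <= r' -> near_rips c r w -> near_rips c r' w.
Proof. by move=> rr' [x cx xr]; exists x => //; exact: le_trans xr rr'. Qed.

Lemma near_rips_shift (d : R) c r w w' :
  near_rips c r w -> mdist w' w < d -> near_rips c (r + d) w'.
Proof.
move=> [x cx xr] ww'; exists x => //; apply: le_trans (lerD xr (ltW ww')).
by rewrite -addrA lerD2l addrC metric_triangle.
Qed.

(** The image of a Rips simplex, with rho = r, is itself a common centre. Conversely, two points
    near a centre have distance less than (r - rho) + 2 rho + (r - rho) = 2 r, by passing through
    two points of the centre. *)
Lemma rips_centred (X : finMetricType R) (phi : isometric_embedding X W) (a : J R) :
  (0 < #|X|)%N ->
  large_faces (rips X (val a).2) ((val a).1 * #|X|%:R) = centred near_rips phi a.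
Proof.
move=> X0; apply/seteqP; split=> s.
- move=> [sR ks]; split=> //.
  have sdist x y : x \in s -> y \in s -> mdist x y < 2 * (val a).2.
    move=> xs ys; have [<-|xy] := eqVneq x y.
      by rewrite mdistxx mulr_gt0 //; case/andP: (valP a).
    move: sR; rewrite inE => /andP[_ /forall_inP/(_ _ xs)/forall_inP/(_ _ ys)].
    by rewrite /rips_edge xy => /andP[].
  have cP x y : [set phi z | z in [set` s]] x -> [set phi z | z in [set` s]] y ->
      mdist x y < 2 * (val a).2.
    by move=> [x' xs <-] [y' ys <-]; rewrite isom_dist sdist.
  exists (exist _ ([set phi z | z in [set` s]], (val a).2) cP) => x xs.
  by exists (phi x) => /=; [exists x | rewrite mdistxx addr0].
- move=> [ks [c sc]]; split=> //; rewrite inE; apply/andP; split.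
    rewrite -card_gt0 -(ltr_nat R); apply: lt_le_trans ks.
    by rewrite mulr_gt0 ?ltr0n //; case/andP: (valP a).
  apply/forall_inP => x /sc[x' cx xx']; apply/forall_inP => y /sc[y' cy yy'].
  apply/implyP => xy; rewrite /rips_edge xy /= -(isom_dist phi).
  have cxy := svalP c _ _ cx cy.
  have := metric_triangle (phi x) x' (phi y).
  have := metric_triangle x' y' (phi y); rewrite (metric_sym y').
  move: xx' yy' cxy; rewrite /=. lra.
Qed.

End rips.

Theorem theorem1p6 (R : realType) :
  [/\ forall (Z : metricType R) (X Y : {fset Z}),
        X != fset0 -> Y != fset0 ->
        (dI (multicover X) (multicover Y) <= prohorov (nu X) (nu Y))%E,
      forall (Z : metricType R) (X Y : {fset Z}),
        X != fset0 -> Y != fset0 -> good Z ->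
        (dHI (subdiv_cech X) (subdiv_cech Y) <= prohorov (nu X) (nu Y))%E &
      forall X Y : finMetricType R,
        (0 < #|X|)%N -> (0 < #|Y|)%N ->
        (dHI (subdiv_rips X) (subdiv_rips Y)
           <= gromov_prohorov (mu X) (mu Y))%E].
Proof.
split=> [Z X Y X0 Y0|Z X Y X0 Y0 _|X Y X0 Y0].
- apply: (@prohorov_bound _ _ _ _ (fun x : X => val x) (fun y : Y => val y))
    => // d XY YX.
  apply: ereal_inf_lbound; exists d => //=; apply: filtration_interleaved => a b ab y.
  (* The shift keeps each central set, here [[set y]], and so keeps the point [y]. *)
  + rewrite !multicover_central //=; apply: central_shift ab _ => //;
      by [exact: fset_card_gt0 | exact: in_ballS | exact: in_ball_shift].
  + rewrite !multicover_central //=; apply: central_shift ab _ => //;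
      by [exact: fset_card_gt0 | exact: in_ballS | exact: in_ball_shift].
- apply: (@prohorov_bound _ _ _ _ (fun x : X => val x) (fun y : Y => val y))
    => // d XY YX.
  apply: ereal_inf_lbound; exists d => //=.
  apply: (@subdiv_homotopy_interleaved _ _ _ _ _ _ _ (@in_ball R Z) d
    (fun a => cech X (val a).2) (fun a => cech Y (val a).2)
    (fun a => (val a).1 * #|` X|%:R) (fun a => (val a).1 * #|` Y|%:R)
    (@subdiv_cech_setS R Z X) (@subdiv_cech_setS R Z Y) _ _ _ _ _ _ XY YX).
  + exact: fset_card_gt0.
  + exact: fset_card_gt0.
  + exact: in_ballS.
  + exact: in_ball_shift.
  + by move=> a; exact: cech_centred.
  + by move=> a; exact: cech_centred.
(* A bound for each pair of embeddings suffices; the image of [mu X] under [phi] is by computation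
   [unif R phi]. *)
- apply: le_ereal_inf_tmp => _ [W [phi [psi ->]]].
  apply: (@prohorov_bound _ _ _ _ phi psi) => // d XY YX.
  apply: ereal_inf_lbound; exists d => //=.
  apply: (@subdiv_homotopy_interleaved _ _ _ _ _ _ _ (@near_rips R W) d
    (fun a => rips X (val a).2) (fun a => rips Y (val a).2)
    (fun a => (val a).1 * #|X|%:R) (fun a => (val a).1 * #|Y|%:R)
    (@subdiv_rips_setS R X) (@subdiv_rips_setS R Y) _ _ _ _ _ _ XY YX) => //.
  + exact: near_ripsS.
  + exact: near_rips_shift.
  + by move=> a; exact: rips_centred.
  + by move=> a; exact: rips_centred.
Qed.
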